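(* For every non-principal ultrafilter $\mathcal U$ on $\mathbb N$, the ultrapower $(\mathcal A/\mathcal J)_{\mathcal U}$ is not simple, and hence not purely infinite.
   Context: Let $\mathrm{Cu}_2$ be the involutive monoid with identity $e$ and zero element $\lozenge$ (so $\lozenge t=\lozenge=t\lozenge$ for all $t$), generated by $s_1,s_2,s_1^*,s_2^*$ subject to $s_1^*s_1=e=s_2^*s_2$ and $s_1^*s_2=\lozenge=s_2^*s_1$, with involution $t\mapsto t^*$ satisfying $(t^* )^*=t$, $(tu)^*=u^*t^*$. Let $\mathcal A=\ell^1(\mathrm{Cu}_2\setminus\{\lozenge\})$ with product $\#$ determined by bilinearity and continuity from $\delta_s\#\delta_t=\delta_{st}$ if $st\neq\lozenge$ and $\delta_s\#\delta_t=0$ if $st=\lozenge$; this is a unital Banach $*$-algebra with unit $\delta_e$. Let $f_0=\delta_e-\delta_{s_1s_1^*}-\delta_{s_2s_2^*}$ and let $\mathcal J$ be the closed two-sided ideal of $\mathcal A$ generated by $f_0$; $\mathcal A/\mathcal J$ carries the quotient norm. For a Banach algebra $\mathcal B$, the ultrapower is $(\mathcal B)_{\mathcal U}=\ell^\infty(\mathcal B)/c_{\mathcal U}(\mathcal B)$, where $\ell^\infty(\mathcal B)$ is the Banach algebra of bounded sequences with pointwise operations and sup norm and $c_{\mathcal U}(\mathcal B)$ is the closed ideal of sequences $(b_n)$ with $\lim_{n\to\mathcal U}\|b_n\|=0$. A unital algebra is purely infinite if it is not a division algebra and for every non-zero $a$ there exist $b,c$ with $bac=1$. *)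

(* Defs.v *)
From HB Require Import structures.
From mathcomp Require Import all_boot all_order all_algebra.
From mathcomp Require Import all_classical all_reals.
From mathcomp Require Import esum.
From mathcomp Require Import complex.

Set Implicit Arguments.
Unset Strict Implicit.
Unset Printing Implicit Defensive.

Import Order.TTheory GRing.Theory Num.Theory.
Local Open Scope ring_scope.
Local Open Scope classical_set_scope.

(* The polycyclic (Cuntz) monoid Cu_2 in normal form.                        *)
(* Every non-zero element of Cu_2 is uniquely s_a s_b^star for finite words a,b *)
(* over {1,2}; we encode the letter 1 by [false] and 2 by [true], and         *)
(* s_(x_1 ... x_k) = s_(x_1) ... s_(x_k).  The type [Cu2] is Cu_2 \ {<>}.    *)
Definition Cu2 : Type := (seq bool * seq bool)%type.

Definition Cu2_e : Cu2 := ([::], [::]).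

(* product in Cu_2, [None] standing for the zero element <> :
   (s_a s_b^star)(s_c s_d^star) = s_(a m) s_d^star   if c = b m,
                          = s_a s_(d m)^star   if b = c m,
                          = <>              otherwise.                       *)
Definition Cu2_mul (x y : Cu2) : option Cu2 :=
  let: (a, b) := x in let: (c, d) := y in
  if prefix b c then Some (a ++ drop (size b) c, d)
  else if prefix c b then Some (a, d ++ drop (size c) b)
  else None.

Definition Cu2_star (x : Cu2) : Cu2 := (x.2, x.1).

Section L1.
Variable R : realType.
Local Notation C := R[i].

Definition psum (T : choiceType) (h : T -> R) : R :=
  fine (\esum_(x in [set: T]) (h x)%:E)%E.

Definition rsum (T : choiceType) (h : T -> R) : R :=
  psum (fun x => Num.max (h x) 0) - psum (fun x => Num.max (- h x) 0).

Definition csum (T : choiceType) (h : T -> C) : C :=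
  Complex (rsum (fun x => complex.Re (h x))) (rsum (fun x => complex.Im (h x))).

Definition inA (f : Cu2 -> C) : Prop :=
  summable [set: Cu2] (fun s => (Normc.normc (f s))%:E).

Definition normA (f : Cu2 -> C) : R := psum (fun s => Normc.normc (f s)).

Definition addA (f g : Cu2 -> C) : Cu2 -> C := fun s => f s + g s.
Definition oppA (f : Cu2 -> C) : Cu2 -> C := fun s => - f s.
Definition subA (f g : Cu2 -> C) : Cu2 -> C := fun s => f s - g s.
Definition zeroA : Cu2 -> C := fun _ => 0.

Definition mulA (f g : Cu2 -> C) : Cu2 -> C := fun u =>
  csum (fun p : Cu2 * Cu2 =>
          if Cu2_mul p.1 p.2 == Some u then f p.1 * g p.2 else 0).

Definition delta (s : Cu2) : Cu2 -> C := fun t => if t == s then 1 else 0.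

Definition f0 : Cu2 -> C :=
  subA (subA (delta Cu2_e) (delta ([:: false], [:: false])))
       (delta ([:: true], [:: true])).

(* J = closure of the two-sided ideal generated by f_0 (A is unital, so
   that ideal is { sum_i a_i # f_0 # b_i } ) *)
Definition inJ (f : Cu2 -> C) : Prop :=
  inA f /\
  forall eps : R, 0 < eps ->
    exists ab : seq ((Cu2 -> C) * (Cu2 -> C)),
      (forall p, p \in ab -> inA p.1 /\ inA p.2) /\
      normA (subA f (foldr (fun p acc => addA (mulA (mulA p.1 f0) p.2) acc)
                           zeroA ab)) < eps.

Definition qnorm (f : Cu2 -> C) : R :=
  inf [set normA (subA f j) | j in inJ].

End L1.

(* Rings presented as a carrier predicate on a type with an equivalence     *)
(* (a "setoid ring"): the ring meant is the quotient of the carrier by req. *)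
Record sring := SRing {
  sr_T : Type;
  sr_car : sr_T -> Prop;
  sr_eq : sr_T -> sr_T -> Prop;
  sr_add : sr_T -> sr_T -> sr_T;
  sr_opp : sr_T -> sr_T;
  sr_mul : sr_T -> sr_T -> sr_T;
  sr_zero : sr_T;
  sr_one : sr_T }.
Arguments sr_car : clear implicits.
Arguments sr_eq : clear implicits.
Arguments sr_add : clear implicits.
Arguments sr_opp : clear implicits.
Arguments sr_mul : clear implicits.
Arguments sr_zero : clear implicits.
Arguments sr_one : clear implicits.

(* two-sided ideals of the quotient ring, as saturated subsets *)
Definition sr_ideal (Q : sring) (I : sr_T Q -> Prop) : Prop :=
  (forall x, I x -> sr_car Q x) /\
  I (sr_zero Q) /\
  (forall x y, I x -> I y -> I (sr_add Q x y)) /\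
  (forall x, I x -> I (sr_opp Q x)) /\
  (forall x r, I x -> sr_car Q r -> I (sr_mul Q r x) /\ I (sr_mul Q x r)) /\
  (forall x y, I x -> sr_car Q y -> sr_eq Q x y -> I y).

Definition sr_simple (Q : sring) : Prop :=
  ~ sr_eq Q (sr_one Q) (sr_zero Q) /\
  forall I, sr_ideal I ->
    (forall x, I x -> sr_eq Q x (sr_zero Q)) \/ I (sr_one Q).

Definition sr_division (Q : sring) : Prop :=
  ~ sr_eq Q (sr_one Q) (sr_zero Q) /\
  forall a, sr_car Q a -> ~ sr_eq Q a (sr_zero Q) ->
    exists b, sr_car Q b /\ sr_eq Q (sr_mul Q a b) (sr_one Q) /\
              sr_eq Q (sr_mul Q b a) (sr_one Q).

Definition sr_purely_infinite (Q : sring) : Prop :=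
  ~ sr_division Q /\
  forall a, sr_car Q a -> ~ sr_eq Q a (sr_zero Q) ->
    exists b c, sr_car Q b /\ sr_car Q c /\
                sr_eq Q (sr_mul Q (sr_mul Q b a) c) (sr_one Q).

(* The ultrapower (A/J)_U = l^oo(A/J) / c_U(A/J).  An element of l^oo(A/J)  *)
(* is represented by a sequence of representatives x_n in A whose classes   *)
(* are bounded in the quotient norm; (x_n) ~ (y_n) iff                      *)
(* lim_{n -> U} || [x_n - y_n] ||_{A/J} = 0.                                *)
Section Ultrapower.
Variable R : realType.
Variable U : set_system nat.
Local Notation C := R[i].

Definition UP_car (x : nat -> Cu2 -> C) : Prop :=
  (forall n, inA (x n)) /\ exists M : R, forall n, qnorm (x n) <= M.

Definition UP_eq (x y : nat -> Cu2 -> C) : Prop :=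
  forall eps : R, 0 < eps -> U [set n | qnorm (subA (x n) (y n)) < eps].

Definition UP_ring : sring :=
  @SRing (nat -> Cu2 -> C) UP_car UP_eq
    (fun x y n => addA (x n) (y n))
    (fun x n => oppA (x n))
    (fun x y n => mulA (x n) (y n))
    (fun _ => @zeroA R)
    (fun _ => delta R Cu2_e).

End Ultrapower.

Definition nonprincipal_ultrafilter (U : set_system nat) : Prop :=
  UltraFilter U /\ forall n : nat, ~ U [set n].

(* Main.v *)
(** Let a_n = 2^-n (sum of s_w over the words w of length n). The bounded
    function phi(s_a s_b^star) = [b is a power of the letter 1] satisfies
    phi(s_a s_b^star) = phi(s_(a1) s_(b1)^star) + phi(s_(a2) s_(b2)^star), so it
    induces a functional of norm 1 on A/J; as phi(a_n) = 1, the sequence (a_n) is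
    non-zero in the ultrapower. On the other hand A/J acts contractively on the
    bounded functions on {1,2}^N by
    (s_a s_b^star . xi)(x) = xi(b y) if x = a y and 0 otherwise, and there a_n has
    norm 2^-n, since the ranges of the s_w are disjoint. The sequences whose norm
    in this representation tends to 0 along U form an ideal that contains (a_n)
    but not 1. The representation is handled through its matrix coefficients:
    functions on the monoid with the additivity property of phi whose support
    involves only a chain of words a. *)

From mathcomp Require Import all_boot all_order all_algebra.
From mathcomp Require Import all_classical all_reals.
From mathcomp Require Import ereal esum complex ring lra.
Require Import Defs.

Set Implicit Arguments.
Unset Strict Implicit.
Unset Printing Implicit Defensive.

Import Order.TTheory GRing.Theory Num.Theory.
Local Open Scope ring_scope.
Local Open Scope classical_set_scope.

Section NonnegativeSums.
Variable R : realType.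

Definition psummable (T : choiceType) (p : T -> R) : Prop :=
  (forall x, 0 <= p x) /\ (\esum_(x in [set: T]) (p x)%:E < +oo)%E.

Lemma psum_EFin (T : choiceType) (p : T -> R) : psummable p ->
  (psum p)%:E = (\esum_(x in [set: T]) (p x)%:E)%E.
Proof.
move=> [p0 fp]; rewrite /psum fineK// ge0_fin_numE//.
by apply: esum_ge0 => x _; rewrite lee_fin.
Qed.

Lemma psum_ge0 (T : choiceType) (p : T -> R) : (forall x, 0 <= p x) ->
  0 <= psum p.
Proof. by move=> p0; apply: fine_ge0; apply: esum_ge0 => x _; rewrite lee_fin. Qed.

Lemma eq_psum (T : choiceType) (p q : T -> R) : p =1 q -> psum p = psum q.
Proof. by move=> /funext ->. Qed.

Lemma psummable_le (T : choiceType) (p q : T -> R) :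
  (forall x, 0 <= p x) -> (forall x, p x <= q x) -> psummable q -> psummable p.
Proof.
move=> p0 pq [_ fq]; split => //; apply: le_lt_trans fq.
by apply: le_esum => x _; rewrite lee_fin.
Qed.

Lemma psum_le (T : choiceType) (p q : T -> R) :
  (forall x, 0 <= p x) -> (forall x, p x <= q x) -> psummable q ->
  psum p <= psum q.
Proof.
move=> p0 pq sq; rewrite -lee_fin !psum_EFin//; last exact: psummable_le pq sq.
by apply: le_esum => x _; rewrite lee_fin.
Qed.

Lemma psummableD (T : choiceType) (p q : T -> R) :
  psummable p -> psummable q -> psummable (fun x => p x + q x).
Proof.
move=> sp sq; split=> [x|]; first by rewrite addr_ge0 ?(sp.1, sq.1).
under eq_esum do rewrite EFinD.
rewrite esumD; try by move=> x _; rewrite lee_fin ?(sp.1, sq.1).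
by rewrite lte_add_pinfty// ?(sp.2, sq.2).
Qed.

Lemma psumD (T : choiceType) (p q : T -> R) :
  psummable p -> psummable q ->
  psum (fun x => p x + q x) = psum p + psum q.
Proof.
move=> sp sq; apply: EFin_inj; rewrite EFinD !psum_EFin//; last exact: psummableD.
under eq_esum do rewrite EFinD.
by rewrite esumD// => x _; rewrite lee_fin ?(sp.1, sq.1).
Qed.

Lemma esumZl (T : choiceType) (c : R) (p : T -> R) :
  0 <= c -> (forall x, 0 <= p x) ->
  (\esum_(x in [set: T]) (c * p x)%:E = c%:E * \esum_(x in [set: T]) (p x)%:E)%E.
Proof.
move=> c0 p0; rewrite /esum -ereal_supZl//; last first.
  apply/set0P; exists 0%E; exists set0; first exact: fsets_set0.
  by rewrite fsbig_set0.
congr ereal_sup; apply/seteqP; split=> [_ [A fA <-]|_ [_ [A fA <-] <-]].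
  exists (\sum_(x \in A) (p x)%:E)%E; first by exists A.
  by rewrite ge0_mule_fsumr// => x; rewrite lee_fin.
by exists A => //; rewrite ge0_mule_fsumr// => x; rewrite lee_fin.
Qed.

Lemma psummableZ (T : choiceType) (c : R) (p : T -> R) :
  0 <= c -> psummable p -> psummable (fun x => c * p x).
Proof.
move=> c0 sp; split=> [x|]; first by rewrite mulr_ge0 ?sp.1.
rewrite esumZl//; last exact: sp.1.
by rewrite -psum_EFin// -EFinM ltry.
Qed.

Lemma psumZ (T : choiceType) (c : R) (p : T -> R) :
  0 <= c -> psummable p -> psum (fun x => c * p x) = c * psum p.
Proof.
move=> c0 sp; apply: EFin_inj; rewrite EFinM !psum_EFin//; last exact: psummableZ.
by rewrite esumZl//; exact: sp.1.
Qed.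

Lemma esum_pair (T S : choiceType) (p : T * S -> R) : (forall x, 0 <= p x) ->
  (\esum_(x in [set: T * S]) (p x)%:E =
   \esum_(t in [set: T]) \esum_(s in [set: S]) (p (t, s))%:E)%E.
Proof.
move=> p0; rewrite (@esum_esum _ _ _ setT (fun=> setT) (fun t s => (p (t, s))%:E)).
  have -> : [set: T] `*`` (fun=> [set: S]) = [set: T * S] by apply/seteqP; split.
  by apply: eq_esum => -[].
by move=> t s _ _; rewrite lee_fin.
Qed.

Lemma psum_fubini (T S : choiceType) (p : T * S -> R) : psummable p ->
  [/\ forall t, psummable (fun s => p (t, s)),
      psummable (fun t => psum (fun s => p (t, s))) &
      psum p = psum (fun t => psum (fun s => p (t, s)))].
Proof.
move=> sp; have [p0 fp] := sp; move: fp; rewrite esum_pair// => fp.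
have slice t : psummable (fun s => p (t, s)).
  split=> //; have := @summable_pinfty _ R [set: T]
    (fun t => \esum_(s in [set: S]) (p (t, s))%:E)%E.
  have e0 t' : (0 <= \esum_(s in [set: S]) (p (t', s))%:E)%E.
    by apply: esum_ge0 => s _; rewrite lee_fin.
  move=> /(_ _ t I); rewrite gee0_abs//; apply.
  by rewrite /summable; under eq_esum do rewrite gee0_abs//.
have outer : psummable (fun t => psum (fun s => p (t, s))).
  split=> [t|]; first by apply: psum_ge0.
  by under eq_esum do rewrite psum_EFin//.
split=> //; apply: EFin_inj; rewrite !psum_EFin// esum_pair//.
by apply: eq_esum => t _; rewrite psum_EFin.
Qed.

Lemma psummable_pair (T S : choiceType) (p : T * S -> R) :
  (forall t, psummable (fun s => p (t, s))) ->
  psummable (fun t => psum (fun s => p (t, s))) -> psummable p.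
Proof.
move=> sl out; have p0 x : 0 <= p x by case: x => t s; exact: (sl t).1.
split=> //; rewrite esum_pair//.
by under eq_esum do rewrite -psum_EFin//; exact: out.2.
Qed.

Lemma esum_swap (T S : choiceType) (p : T * S -> \bar R) :
  (\esum_(x in [set: S * T]) p (x.2, x.1) = \esum_(x in [set: T * S]) p x)%E.
Proof.
rewrite (@reindex_esum _ _ _ [set: S * T] _ (fun x => (x.2, x.1)))//; split=> //.
- by move=> [a b] [c d] _ _ [-> ->].
- by move=> [a b] _; exists (b, a).
Qed.

Lemma psummable_swap (T S : choiceType) (p : T * S -> R) :
  psummable p -> psummable (fun x => p (x.2, x.1)).
Proof.
move=> [p0 fp]; split=> //.
by rewrite (esum_swap (fun x => (p x)%:E)).
Qed.

Lemma psum_swap (T S : choiceType) (p : T * S -> R) :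
  psum (fun x => p (x.2, x.1)) = psum p.
Proof. by rewrite /psum (esum_swap (fun x => (p x)%:E)). Qed.

Lemma esum_point (T : choiceType) (a : T) (p : T -> R) :
  (forall x, 0 <= p x) -> (forall x, x != a -> p x = 0) ->
  (\esum_(x in [set: T]) (p x)%:E = (p a)%:E)%E.
Proof.
move=> p0 pa; rewrite -(esum_set1 (a := fun x => (p x)%:E)) ?lee_fin//.
rewrite [RHS]esum_mkcond; apply: eq_esum => x _.
case: ifPn => // /negP xa; rewrite pa//; apply/eqP => e; apply: xa.
by rewrite inE.
Qed.

Lemma psummable_point (T : choiceType) (a : T) (p : T -> R) :
  (forall x, 0 <= p x) -> (forall x, x != a -> p x = 0) -> psummable p.
Proof. by move=> p0 pa; split=> //; rewrite (esum_point p0 pa) ltry. Qed.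

Lemma psum_point (T : choiceType) (a : T) (p : T -> R) :
  (forall x, 0 <= p x) -> (forall x, x != a -> p x = 0) -> psum p = p a.
Proof. by move=> p0 pa; rewrite /psum (esum_point p0 pa). Qed.

End NonnegativeSums.

Section RealSums.
Variable R : realType.

Definition rsummable (T : choiceType) (h : T -> R) : Prop :=
  psummable (fun x => `|h x|).

Lemma rsum_diff (T : choiceType) (h p q : T -> R) :
  psummable p -> psummable q -> (forall x, h x = p x - q x) ->
  rsum h = psum p - psum q.
Proof.
move=> sp sq hpq; rewrite /rsum.
set hp := fun x => _; set hn := fun x => Num.max (- h x) 0.
have s1 : psummable hp.
  apply: psummable_le (sp) => x; rewrite /hp ?le_max ?ge_max ?lexx ?orbT//.
  by rewrite sp.1 andbT hpq gerBl sq.1.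
have s2 : psummable hn.
  apply: psummable_le (sq) => x; rewrite /hn ?le_max ?ge_max ?lexx ?orbT//.
  by rewrite sq.1 andbT hpq opprB gerBl sp.1.
suff : psum hp + psum q = psum p + psum hn by lra.
rewrite -!psumD//; apply: eq_psum => x; rewrite /hp /hn.
by have := hpq x; case: (leP (h x) 0) => ?; case: (leP (- h x) 0) => ? ?; lra.
Qed.

Lemma rsummable_parts (T : choiceType) (h : T -> R) : rsummable h ->
  psummable (fun x => Num.max (h x) 0) /\ psummable (fun x => Num.max (- h x) 0).
Proof.
move=> sh; split; apply: psummable_le (sh) => x; rewrite ?le_max ?lexx ?orbT//.
  by rewrite ge_max normr_ge0 ler_norm.
by rewrite ge_max normr_ge0 -normrN ler_norm.
Qed.

Lemma maxrB (x : R) : x = Num.max x 0 - Num.max (- x) 0.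
Proof. by case: (leP x 0) => ?; case: (leP (- x) 0) => ?; lra. Qed.

Lemma eq_rsum (T : choiceType) (h k : T -> R) : h =1 k -> rsum h = rsum k.
Proof. by move=> /funext ->. Qed.

Lemma rsumD (T : choiceType) (h k : T -> R) : rsummable h -> rsummable k ->
  rsum (fun x => h x + k x) = rsum h + rsum k.
Proof.
move=> /rsummable_parts[hp hn] /rsummable_parts[kp kn].
rewrite (@rsum_diff _ _ _ _ (psummableD hp kp) (psummableD hn kn)).
  by rewrite !psumD// /rsum; lra.
by move=> x; have := maxrB (h x); have := maxrB (k x); lra.
Qed.

Lemma rsumZ (T : choiceType) (c : R) (h : T -> R) : rsummable h ->
  rsum (fun x => c * h x) = c * rsum h.
Proof.
move=> /rsummable_parts[hp hn]; have [c0|c0] := leP 0 c.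
  rewrite (@rsum_diff _ _ _ _ (psummableZ c0 hp) (psummableZ c0 hn)).
    by rewrite !psumZ// /rsum; lra.
  by move=> x; rewrite -mulrBr -maxrB.
have c0' : 0 <= - c by rewrite oppr_ge0 ltW.
rewrite (@rsum_diff _ _ _ _ (psummableZ c0' hn) (psummableZ c0' hp)).
  by rewrite !psumZ// /rsum; lra.
by move=> x; rewrite -mulrBr [X in c * X]maxrB; ring.
Qed.

Lemma rsum_fubini (T S : choiceType) (h : T * S -> R) : rsummable h ->
  rsum h = rsum (fun t => rsum (fun s => h (t, s))).
Proof.
move=> /rsummable_parts[/psum_fubini[hp1 hp2 hp3] /psum_fubini[hn1 hn2 hn3]].
rewrite {1}/rsum hp3 hn3; symmetry; apply: rsum_diff => // t.
Qed.

Lemma rsum_swap (T S : choiceType) (h : T * S -> R) :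
  rsum (fun x => h (x.2, x.1)) = rsum h.
Proof.
by rewrite /rsum (psum_swap (fun x => Num.max (h x) 0))
  (psum_swap (fun x => Num.max (- h x) 0)).
Qed.

Lemma rsum_point (T : choiceType) (a : T) (h : T -> R) :
  (forall x, x != a -> h x = 0) -> rsum h = h a.
Proof.
move=> ha; rewrite /rsum !(@psum_point _ _ a).
- by rewrite -maxrB.
- by move=> x; rewrite le_max lexx orbT.
- by move=> x /ha ->; rewrite oppr0 maxxx.
- by move=> x; rewrite le_max lexx orbT.
- by move=> x /ha ->; rewrite maxxx.
Qed.

Lemma rsum_le (T : choiceType) (h p : T -> R) : psummable p ->
  (forall x, `|h x| <= p x) -> `|rsum h| <= psum p.
Proof.
move=> sp hp; have sh : rsummable h by apply: psummable_le sp => x.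
have [s1 s2] := rsummable_parts sh.
suff : psum (fun x => Num.max (h x) 0) + psum (fun x => Num.max (- h x) 0)
    <= psum p.
  have := psum_ge0 s1.1; have := psum_ge0 s2.1; rewrite /rsum.
  by rewrite ler_norml; lra.
rewrite -psumD//; apply: psum_le => // x.
  by rewrite addr_ge0// ?s1.1 ?s2.1.
apply: le_trans (hp x).
by case: (leP (h x) 0) => ?; case: (leP (- h x) 0) => ?;
  have := ler_norm (h x); have := ler_norm (- h x); rewrite normrN; lra.
Qed.

End RealSums.

Section ComplexSums.
Variable R : realType.
Local Notation C := R[i].
Local Notation normc := (@Normc.normc R).
Local Notation Re := (@complex.Re R).
Local Notation Im := (@complex.Im R).

Lemma normc_ge0 (x : C) : 0 <= normc x.
Proof. by case: x => a b; exact: sqrtr_ge0. Qed.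

Lemma normc_zero : normc (0 : C) = 0.
Proof. exact: Normc.normc0. Qed.

Lemma normc_mul (x y : C) : normc (x * y) = normc x * normc y.
Proof. exact: Normc.normcM. Qed.

Lemma normc_add (x y : C) : normc (x + y) <= normc x + normc y.
Proof. exact: le_normcD. Qed.

Lemma normc_opp (x : C) : normc (- x) = normc x.
Proof. exact: normcN. Qed.

Lemma sqr_normcE (x : C) : normc x ^+ 2 = Re x ^+ 2 + Im x ^+ 2.
Proof. by case: x => a b /=; rewrite sqr_sqrtr// addr_ge0 ?sqr_ge0. Qed.

Lemma normr_Re_le (x : C) : `|Re x| <= normc x.
Proof.
rewrite -(ger0_norm (normc_ge0 x)) -ler_sqr ?nnegrE// !real_normK ?num_real//.
by rewrite sqr_normcE lerDl sqr_ge0.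
Qed.

Lemma normr_Im_le (x : C) : `|Im x| <= normc x.
Proof.
rewrite -(ger0_norm (normc_ge0 x)) -ler_sqr ?nnegrE// !real_normK ?num_real//.
by rewrite sqr_normcE lerDr sqr_ge0.
Qed.

Definition csummable (T : choiceType) (h : T -> C) : Prop :=
  psummable (fun x => normc (h x)).

Lemma csummable_le (T : choiceType) (h : T -> C) (p : T -> R) :
  (forall x, normc (h x) <= p x) -> psummable p -> csummable h.
Proof. by apply: psummable_le => x; exact: normc_ge0. Qed.

Lemma csummable_Re (T : choiceType) (h : T -> C) :
  csummable h -> rsummable (fun x => Re (h x)).
Proof. by apply: psummable_le => x //; exact: normr_Re_le. Qed.

Lemma csummable_Im (T : choiceType) (h : T -> C) :
  csummable h -> rsummable (fun x => Im (h x)).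
Proof. by apply: psummable_le => x //; exact: normr_Im_le. Qed.

Lemma csummableD (T : choiceType) (h k : T -> C) :
  csummable h -> csummable k -> csummable (fun x => h x + k x).
Proof.
by move=> sh sk; apply: csummable_le (psummableD sh sk) => x; exact: normc_add.
Qed.

Lemma csummableN (T : choiceType) (h : T -> C) :
  csummable h -> csummable (fun x => - h x).
Proof. by apply: csummable_le => x; rewrite normc_opp. Qed.

Lemma csummable_bounded (T : choiceType) (f h : T -> C) (M : R) :
  csummable f -> (forall x, normc (h x) <= M) -> csummable (fun x => f x * h x).
Proof.
move=> sf hM; apply: csummable_le (psummableZ (normr_ge0 M) sf) => x.
rewrite normc_mul mulrC ler_wpM2r ?normc_ge0//.
exact: le_trans (hM x) (ler_norm _).
Qed.

Lemma eq_csum (T : choiceType) (h k : T -> C) : h =1 k -> csum h = csum k.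
Proof. by move=> /funext ->. Qed.

Lemma complex_eq (x y : C) : Re x = Re y -> Im x = Im y -> x = y.
Proof. by case: x y => [a b] [c d] /= -> ->. Qed.

Lemma ReD (x y : C) : Re (x + y) = Re x + Re y.
Proof. by case: x y => [a b] [c d]. Qed.

Lemma ImD (x y : C) : Im (x + y) = Im x + Im y.
Proof. by case: x y => [a b] [c d]. Qed.

Lemma ReM (x y : C) : Re (x * y) = Re x * Re y - Im x * Im y.
Proof. by case: x y => [a b] [c d]. Qed.

Lemma ImM (x y : C) : Im (x * y) = Re x * Im y + Im x * Re y.
Proof. by case: x y => [a b] [c d]. Qed.

Lemma csumD (T : choiceType) (h k : T -> C) : csummable h -> csummable k ->
  csum (fun x => h x + k x) = csum h + csum k.
Proof.
move=> sh sk; apply: complex_eq; rewrite ?(ReD, ImD) /=.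
  rewrite -rsumD; try exact: csummable_Re.
  by apply: eq_rsum => x; rewrite ReD.
rewrite -rsumD; try exact: csummable_Im.
by apply: eq_rsum => x; rewrite ImD.
Qed.

Lemma rsummableZ (T : choiceType) (c : R) (h : T -> R) :
  rsummable h -> rsummable (fun x => c * h x).
Proof.
move=> sh; apply: psummable_le (psummableZ (normr_ge0 c) sh) => x //.
by rewrite normrM.
Qed.

Lemma csumZ (T : choiceType) (c : C) (h : T -> C) : csummable h ->
  csum (fun x => c * h x) = c * csum h.
Proof.
move=> sh; have sR := csummable_Re sh; have sI := csummable_Im sh.
apply: complex_eq; rewrite ?(ReM, ImM) /=.
  rewrite -mulNr -!rsumZ// -rsumD; try exact: rsummableZ.
  by apply: eq_rsum => x; rewrite ReM mulNr.
rewrite -!rsumZ// -rsumD; try exact: rsummableZ.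
by apply: eq_rsum => x; rewrite ImM.
Qed.

Lemma csumN (T : choiceType) (h : T -> C) : csummable h ->
  csum (fun x => - h x) = - csum h.
Proof.
move=> sh; rewrite -mulN1r -csumZ//.
by apply: eq_csum => x; rewrite mulN1r.
Qed.

(* Rotating the sum onto the real axis reduces the bound to [rsum_le]. *)
Lemma normc_csum (T : choiceType) (h : T -> C) : csummable h ->
  normc (csum h) <= psum (fun x => normc (h x)).
Proof.
move=> sh; set v := csum h; set S := psum _.
have [v0|v0] := eqVneq (normc v) 0.
  by rewrite v0; apply: psum_ge0 => x; exact: normc_ge0.
have vp : 0 < normc v by rewrite lt_def v0 normc_ge0.
pose w : C := Complex (Re v) (- Im v).
have nw : normc w = normc v by rewrite /w; case: (v) => a b /=; rewrite sqrrN.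
rewrite -(ler_pM2l vp) -expr2.
have -> : normc v ^+ 2 = Re (w * v).
  by rewrite sqr_normcE ReM /=; ring.
rewrite -csumZ// /=; apply: le_trans (ler_norm _) _.
rewrite -psumZ ?normc_ge0//; apply: rsum_le.
  exact: (psummableZ (normc_ge0 v) sh).
by move=> x; apply: le_trans (normr_Re_le _) _; rewrite normc_mul nw.
Qed.

Lemma csum_fubini (T S : choiceType) (h : T * S -> C) : csummable h ->
  csum h = csum (fun t => csum (fun s => h (t, s))).
Proof.
move=> sh; apply: complex_eq => /=.
  by rewrite rsum_fubini//; exact: csummable_Re.
by rewrite rsum_fubini//; exact: csummable_Im.
Qed.

Lemma csummable_slice (T S : choiceType) (h : T * S -> C) t : csummable h ->
  csummable (fun s => h (t, s)).
Proof. by move=> sh; have [s _ _] := psum_fubini sh; exact: s. Qed.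

Lemma csum_swap (T S : choiceType) (h : T * S -> C) :
  csum (fun x => h (x.2, x.1)) = csum h.
Proof.
apply: complex_eq => /=.
  exact: (rsum_swap (fun x => Re (h x))).
exact: (rsum_swap (fun x => Im (h x))).
Qed.

Lemma csummable_swap (T S : choiceType) (h : T * S -> C) :
  csummable h -> csummable (fun x => h (x.2, x.1)).
Proof. exact: psummable_swap. Qed.

Lemma csum_exchange (T S : choiceType) (h : T * S -> C) : csummable h ->
  csum (fun t => csum (fun s => h (t, s))) =
  csum (fun s => csum (fun t => h (t, s))).
Proof.
move=> sh; rewrite -csum_fubini// -csum_swap csum_fubini//.
exact: csummable_swap.
Qed.

Lemma csum_point (T : choiceType) (a : T) (h : T -> C) :
  (forall x, x != a -> h x = 0) -> csum h = h a.
Proof.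
move=> ha; apply: complex_eq; rewrite /= (@rsum_point _ _ a)//;
  by move=> x /ha ->.
Qed.

Lemma csummable_point (T : choiceType) (a : T) (h : T -> C) :
  (forall x, x != a -> h x = 0) -> csummable h.
Proof.
move=> ha; apply: (@psummable_point _ _ a) => [x|x /ha ->]; first exact: normc_ge0.
exact: normc_zero.
Qed.

Lemma csum_marginal (T S : choiceType) (h : T * S -> C) : csummable h ->
  csummable (fun t => csum (fun s => h (t, s))) /\
  psum (fun t => normc (csum (fun s => h (t, s)))) <= psum (fun x => normc (h x)).
Proof.
move=> sh; have [s1 s2 ->] := psum_fubini sh.
have le t : normc (csum (fun s => h (t, s))) <= psum (fun s => normc (h (t, s))).
  exact: normc_csum (s1 t).
split; first exact: csummable_le le s2.
by apply: psum_le => // t; exact: normc_ge0.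
Qed.

End ComplexSums.

Section PolycyclicMonoid.

Local Arguments Cu2_mul : simpl never.

Definition comparable_words (b c : seq bool) : bool := prefix b c || prefix c b.

Lemma comparable_wordsC b c : comparable_words b c = comparable_words c b.
Proof. exact: orbC. Qed.

Lemma comparable_words_catr b c k :
  comparable_words b (c ++ k) -> comparable_words b c.
Proof.
elim: b c => [|x b IH] [|y c] //=.
rewrite /comparable_words /=; rewrite (eq_sym y x).
by case: eqP => //= _; exact: IH.
Qed.

Lemma comparable_words_catl b c k :
  comparable_words (b ++ k) c -> comparable_words b c.
Proof.
by rewrite !(comparable_wordsC _ c); exact: comparable_words_catr.
Qed.

Lemma comparable_words_cat2l a b c :
  comparable_words (a ++ b) (a ++ c) = comparable_words b c.
Proof. by elim: a => //= x a IH; rewrite /comparable_words /= eqxx. Qed.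

Lemma comparable_words_cat b k : comparable_words b (b ++ k).
Proof. by rewrite /comparable_words prefix_prefix. Qed.

Lemma wordsP b c :
  [\/ exists m, c = b ++ m, exists m, b = c ++ m | ~~ comparable_words b c].
Proof.
rewrite /comparable_words; case: (boolP (prefix b c)) => [/prefixP[m ->]|_] /=.
  by apply: Or31; exists m.
case: (boolP (prefix c b)) => [/prefixP[m ->]|_] /=; last exact: Or33.
by apply: Or32; exists m.
Qed.

Lemma Cu2_mul_catr a b m d : Cu2_mul (a, b) (b ++ m, d) = Some (a ++ m, d).
Proof. by rewrite /Cu2_mul prefix_prefix drop_size_cat. Qed.

Lemma Cu2_mul_catl a c m d : Cu2_mul (a, c ++ m) (c, d) = Some (a, d ++ m).
Proof.
rewrite /Cu2_mul prefix_prefix drop_size_cat//; case: ifP => // /prefixP[k e].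
have : size c = size ((c ++ m) ++ k) by rewrite -e.
rewrite !size_cat => sz.
have /eqP : (size m + size k == 0)%N by rewrite -(eqn_add2l (size c)) addn0 addnA -sz.
move=> /eqP; rewrite addn_eq0 => /andP[/eqP/size0nil m0 /eqP/size0nil k0].
by rewrite m0 addn0 drop_size !cats0.
Qed.

Lemma Cu2_mul_incomparable a b c d :
  ~~ comparable_words b c -> Cu2_mul (a, b) (c, d) = None.
Proof. by rewrite negb_or /Cu2_mul => /andP[/negPf -> /negPf ->]. Qed.

Lemma Cu2_mul_cat2 a x m k f :
  Cu2_mul (a, x ++ m) (x ++ k, f) = Cu2_mul (a, m) (k, f).
Proof. by elim: x => // y x <-; rewrite /Cu2_mul /= !eqxx. Qed.

Lemma Cu2_muls1 s : Cu2_mul s Cu2_e = Some s.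
Proof. by case: s => a b; rewrite -[b]cat0s Cu2_mul_catl. Qed.

Lemma Cu2_mul_fst s t u : Cu2_mul s t = Some u -> exists m, u.1 = s.1 ++ m.
Proof.
case: s t => [a b] [c d]; case: (wordsP b c) => [[m ->]|[m ->]|n].
- by rewrite Cu2_mul_catr => -[<-]; exists m.
- by rewrite Cu2_mul_catl => -[<-]; exists [::]; rewrite cats0.
- by rewrite Cu2_mul_incomparable.
Qed.

Lemma Cu2_mulA s t r :
  obind (fun x => Cu2_mul x r) (Cu2_mul s t) = obind (Cu2_mul s) (Cu2_mul t r).
Proof.
case: s t r => [a b] [c d] [e f].
case: (wordsP b c) => [[m ->]|[m ->]|nbc].
- rewrite Cu2_mul_catr; case: (wordsP d e) => [[k ->]|[k ->]|nde] /=.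
  + by rewrite !Cu2_mul_catr /= -!catA Cu2_mul_catr.
  + by rewrite !Cu2_mul_catl /= Cu2_mul_catr.
  + by rewrite !Cu2_mul_incomparable.
- rewrite Cu2_mul_catl; case: (wordsP d e) => [[k ->]|[k ->]|nde] /=.
  + by rewrite Cu2_mul_catr /= !Cu2_mul_cat2.
  + by rewrite -catA !Cu2_mul_catl /= Cu2_mul_catl catA.
  + rewrite [in RHS]Cu2_mul_incomparable//= Cu2_mul_incomparable//.
    by apply: contra nde; exact: comparable_words_catl.
- rewrite Cu2_mul_incomparable//; case: (wordsP d e) => [[k ->]|[k ->]|nde] /=.
  + rewrite Cu2_mul_catr /= Cu2_mul_incomparable//.
    by apply: contra nbc; exact: comparable_words_catr.
  + by rewrite Cu2_mul_catl /= Cu2_mul_incomparable.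
  + by rewrite [X in obind _ X]Cu2_mul_incomparable.
Qed.

End PolycyclicMonoid.

Section InvariantWeights.

Local Arguments Cu2_mul : simpl never.
Variable R : realType.
Local Notation C := R[i].
Local Notation normc := (@Normc.normc R).

(* These are the functions on the monoid annihilating every
   [s_a f0 s_b^star], hence the ideal J. *)
Definition invariant (h : Cu2 -> C) : Prop := forall a b,
  h (a, b) = h (a ++ [:: false], b ++ [:: false])
           + h (a ++ [:: true], b ++ [:: true]).

Definition ext0 (h : Cu2 -> C) (o : option Cu2) : C := oapp h 0 o.

Lemma invariant_translater (h : Cu2 -> C) t :
  invariant h -> invariant (fun s => ext0 h (Cu2_mul s t)).
Proof.
move=> hi a b; case: t => [c d].
case: (wordsP c b) => [[m ->]|[m ->]|n].
- by rewrite -!catA !Cu2_mul_catl /= hi !catA.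
- case: m => [|j m].
    by rewrite cats0 -[X in Cu2_mul (a, X)]cats0 !Cu2_mul_catl /= cats0 hi.
  rewrite Cu2_mul_catr !Cu2_mul_cat2 -[j :: m]cat1s.
  case: j; rewrite Cu2_mul_catr /= -!catA /=; first by rewrite add0r.
  by rewrite addr0.
- rewrite !Cu2_mul_incomparable ?addr0//; rewrite comparable_wordsC//.
    by apply: contra n; exact: comparable_words_catr.
  by apply: contra n; exact: comparable_words_catr.
Qed.

Lemma invariant_translatel (h : Cu2 -> C) s :
  invariant h -> invariant (fun t => ext0 h (Cu2_mul s t)).
Proof.
move=> hi c d; case: s => [a b].
case: (wordsP b c) => [[m ->]|[m ->]|n].
- by rewrite -!catA !Cu2_mul_catr /= hi !catA.
- case: m => [|j m].
    by rewrite cats0 -[X in Cu2_mul _ (X, d)]cats0 !Cu2_mul_catr /= cats0 hi.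
  rewrite Cu2_mul_catl !Cu2_mul_cat2 -[j :: m]cat1s.
  case: j; rewrite Cu2_mul_catl /= -!catA /=; first by rewrite add0r.
  by rewrite addr0.
- rewrite !Cu2_mul_incomparable ?addr0//.
    by apply: contra n; exact: comparable_words_catr.
  by apply: contra n; exact: comparable_words_catr.
Qed.

Lemma ext0_bounded (h : Cu2 -> C) (M : R) o : 0 <= M ->
  (forall s, normc (h s) <= M) -> normc (ext0 h o) <= M.
Proof. by move=> M0 hM; case: o => [u|]; [exact: hM | rewrite [ext0 _ _]/(0 : C) normc_zero]. Qed.

Definition chain_supported (h : Cu2 -> C) : Prop :=
  forall s t, h s != 0 -> h t != 0 -> comparable_words s.1 t.1.

Lemma chain_supported_translatel (h : Cu2 -> C) s :
  chain_supported h -> chain_supported (fun t => ext0 h (Cu2_mul s t)).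
Proof.
move=> hc [c d] [c' d'] /=; case: s => [a b].
case: (wordsP b c) => [[m ->]|[m e]|n]; last first.
- by rewrite Cu2_mul_incomparable ?eqxx.
- case: (wordsP b c') => [[m' ->]|[m' e']|n'].
  + by move=> _ _; rewrite e -catA comparable_words_cat.
  + move=> _ _; apply: (@comparable_words_catr _ _ m'); rewrite -e' e.
    exact: comparable_words_cat.
  + by rewrite [X in _ -> ext0 h X != 0 -> _]Cu2_mul_incomparable ?eqxx.
- case: (wordsP b c') => [[m' ->]|[m' e']|n'].
  + rewrite !Cu2_mul_catr /= => x y.
    by have /= := hc _ _ x y; rewrite !comparable_words_cat2l.
  + by move=> _ _; rewrite e' -catA comparable_wordsC comparable_words_cat.
  + by rewrite [X in _ -> ext0 h X != 0 -> _]Cu2_mul_incomparable ?eqxx.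
Qed.

End InvariantWeights.

Section ConvolutionAlgebra.
Variable R : realType.
Local Notation C := R[i].
Local Notation normc := (@Normc.normc R).
Local Arguments Cu2_mul : simpl never.
Local Arguments Normc.normc : simpl never.
Implicit Types (f g h k j : Cu2 -> C) (M : R).

Definition pairing f h : C := csum (fun s => f s * h s).

Lemma inAP f : inA f <-> csummable f.
Proof.
rewrite /inA /summable /csummable; under eq_esum do
  rewrite gee0_abs ?lee_fin ?normc_ge0//.
by split=> [|[]] //; split=> // x; exact: normc_ge0.
Qed.

Lemma normA_ge0 f : 0 <= normA f.
Proof. by apply: psum_ge0 => s; exact: normc_ge0. Qed.

Lemma inA_add f g : inA f -> inA g -> inA (addA f g).
Proof. by move=> /inAP sf /inAP sg; apply/inAP; exact: csummableD. Qed.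

Lemma inA_opp f : inA f -> inA (oppA f).
Proof. by move=> /inAP sf; apply/inAP; exact: csummableN. Qed.

Lemma inA_sub f g : inA f -> inA g -> inA (subA f g).
Proof. by move=> sf sg; exact: inA_add sf (inA_opp sg). Qed.

Lemma inA_delta s : inA (delta R s).
Proof. by apply/inAP/(@csummable_point _ _ s) => t /negPf ts; rewrite /delta ts. Qed.

Lemma inA_zero : inA (@zeroA R).
Proof. by apply/inAP/(@csummable_point _ _ Cu2_e). Qed.

Lemma inA_f0 : inA (f0 R).
Proof. by do 2?apply: inA_sub; exact: inA_delta. Qed.

Lemma normA_add f g : inA f -> inA g -> normA (addA f g) <= normA f + normA g.
Proof.
move=> /inAP sf /inAP sg; rewrite /normA -psumD//.
apply: psum_le => [s|s|]; [exact: normc_ge0|exact: normc_add|exact: psummableD].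
Qed.

Lemma pairing_bound f h M : inA f -> (forall s, normc (h s) <= M) ->
  normc (pairing f h) <= M * normA f.
Proof.
move=> /inAP sf hM; have M0 : 0 <= M := le_trans (normc_ge0 _) (hM Cu2_e).
apply: le_trans (normc_csum (csummable_bounded sf hM)) _.
rewrite /normA -psumZ//; apply: psum_le => [s|s|].
- exact: normc_ge0.
- by rewrite normc_mul mulrC ler_wpM2r ?normc_ge0.
- exact: psummableZ.
Qed.

Lemma pairingDl f g h M : inA f -> inA g -> (forall s, normc (h s) <= M) ->
  pairing (addA f g) h = pairing f h + pairing g h.
Proof.
move=> /inAP sf /inAP sg hM; rewrite /pairing -csumD.
- by apply: eq_csum => s; rewrite mulrDl.
- exact: csummable_bounded sf hM.
- exact: csummable_bounded sg hM.
Qed.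

Lemma pairingNl f h M : inA f -> (forall s, normc (h s) <= M) ->
  pairing (oppA f) h = - pairing f h.
Proof.
move=> /inAP sf hM; rewrite /pairing -csumN; last exact: csummable_bounded sf hM.
by apply: eq_csum => s; rewrite mulNr.
Qed.

Lemma pairingBl f g h M : inA f -> inA g -> (forall s, normc (h s) <= M) ->
  pairing (subA f g) h = pairing f h - pairing g h.
Proof.
move=> sf sg hM; rewrite -(pairingNl sg hM) -(pairingDl sf (inA_opp sg) hM).
by [].
Qed.

Lemma pairingDr f h k M N : inA f ->
  (forall s, normc (h s) <= M) -> (forall s, normc (k s) <= N) ->
  pairing f (fun s => h s + k s) = pairing f h + pairing f k.
Proof.
move=> /inAP sf hM kN; rewrite /pairing -csumD.
- by apply: eq_csum => s; rewrite mulrDr.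
- exact: csummable_bounded sf hM.
- exact: csummable_bounded sf kN.
Qed.

Lemma eq_pairing f h k : h =1 k -> pairing f h = pairing f k.
Proof. by move=> /funext ->. Qed.

Lemma pairing0r f h : (forall s, h s = 0) -> pairing f h = 0.
Proof. by move=> h0; rewrite /pairing (@csum_point _ _ Cu2_e) => [|x _]; rewrite h0 mulr0. Qed.

Lemma pairing_deltal s h : pairing (delta R s) h = h s.
Proof.
rewrite /pairing (@csum_point _ _ s) => [|t /negPf ts].
  by rewrite /delta eqxx mul1r.
by rewrite /delta ts mul0r.
Qed.

Lemma pairing_deltar f u : pairing f (delta R u) = f u.
Proof.
rewrite /pairing (@csum_point _ _ u) => [|t /negPf ts].
  by rewrite /delta eqxx mulr1.
by rewrite /delta ts mulr0.
Qed.

Lemma normc_delta_le s t : normc (delta R s t) <= 1.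
Proof.
by rewrite /delta; case: ifP => _; rewrite ?normc_zero// (Normc.normc1 R).
Qed.

Lemma psum_prod f g : inA f -> inA g ->
  psummable (fun p : Cu2 * Cu2 => normc (f p.1) * normc (g p.2)) /\
  psum (fun p : Cu2 * Cu2 => normc (f p.1) * normc (g p.2)) = normA f * normA g.
Proof.
move=> /inAP sf /inAP sg; set p := fun p => _.
have e : (fun s => psum (fun t => p (s, t))) = (fun s => normA g * normc (f s)).
  by apply: funext => s; rewrite /p /= psumZ ?normc_ge0// mulrC.
have sp : psummable p.
  apply: psummable_pair => [s|]; first exact: (psummableZ (normc_ge0 (f s)) sg).
  by rewrite e; exact: (psummableZ (normA_ge0 g) sf).
split=> //; have [_ _ ->] := psum_fubini sp.
by rewrite e psumZ ?normA_ge0// mulrC.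
Qed.

Definition conv_term f g (x : Cu2 * (Cu2 * Cu2)) : C :=
  if Cu2_mul x.2.1 x.2.2 == Some x.1 then f x.2.1 * g x.2.2 else 0.

Lemma conv_term_summable f g : inA f -> inA g ->
  csummable (conv_term f g) /\
  psum (fun x => normc (conv_term f g x)) <= normA f * normA g.
Proof.
move=> sf sg; have [sp psE] := psum_prod sf sg.
pose q (x : (Cu2 * Cu2) * Cu2) := normc (conv_term f g (x.2, x.1)).
have q0 x : 0 <= q x by exact: normc_ge0.
have [v v1 v2] : exists2 v : Cu2 * Cu2 -> Cu2,
    (forall p u, u != v p -> q (p, u) = 0) &
    (forall p, q (p, v p) <= normc (f p.1) * normc (g p.2)).
  exists (fun p => odflt Cu2_e (Cu2_mul p.1 p.2)) => p.
    move=> u; rewrite /q /conv_term /=; case: (Cu2_mul p.1 p.2) => [w|] /=.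
      by rewrite (inj_eq Some_inj) eq_sym => /negPf ->; rewrite normc_zero.
    by rewrite normc_zero.
  rewrite /q /conv_term; case: ifP => _; rewrite ?normc_mul//.
  by rewrite normc_zero mulr_ge0 ?normc_ge0.
have slice p : psummable (fun u => q (p, u)).
  by apply: (@psummable_point _ _ (v p)) => // u; exact: v1.
have qv : (fun p => psum (fun u => q (p, u))) = (fun p => q (p, v p)).
  by apply: funext => p; rewrite (@psum_point _ _ (v p))// => u; exact: v1.
have sq : psummable q.
  apply: psummable_pair => //; rewrite qv.
  by apply: psummable_le sp => p.
split.
  have := psummable_swap sq; rewrite /q /= /csummable.
  by congr psummable; apply: funext => -[].
rewrite -(psum_swap (fun x => normc (conv_term f g x))) -psE.
have [_ _ ->] := psum_fubini sq; rewrite qv.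
exact: psum_le.
Qed.

Lemma inA_mul f g : inA f -> inA g -> inA (mulA f g).
Proof.
move=> sf sg; apply/inAP; have [s _] := conv_term_summable sf sg.
exact: (csum_marginal s).1.
Qed.

Lemma normA_mul f g : inA f -> inA g -> normA (mulA f g) <= normA f * normA g.
Proof.
move=> sf sg; have [s le] := conv_term_summable sf sg.
exact: le_trans (csum_marginal s).2 le.
Qed.

Lemma translate_bounded h M : (forall t, normc (h t) <= M) ->
  forall s t, normc (ext0 h (Cu2_mul s t)) <= M.
Proof.
move=> hM s t; apply: ext0_bounded => //.
exact: le_trans (normc_ge0 _) (hM Cu2_e).
Qed.

Lemma pairing_translate_bounded g h M : inA g -> (forall t, normc (h t) <= M) ->
  forall s, normc (pairing g (fun t => ext0 h (Cu2_mul s t))) <= M * normA g.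
Proof.
move=> sg hM s; apply: pairing_bound => //; exact: translate_bounded.
Qed.

Lemma pairing_mulA f g h M : inA f -> inA g -> (forall s, normc (h s) <= M) ->
  pairing (mulA f g) h =
  pairing f (fun s => pairing g (fun t => ext0 h (Cu2_mul s t))).
Proof.
move=> sf sg hM; have [sF _] := conv_term_summable sf sg.
pose G x := conv_term f g x * h x.1.
have sG : csummable G by exact: csummable_bounded sF (fun x => hM x.1).
transitivity (csum (fun u => csum (fun p => G (u, p)))).
  apply: eq_csum => u; rewrite mulrC -csumZ; last exact: csummable_slice u sF.
  by apply: eq_csum => p; rewrite mulrC.
rewrite csum_exchange//.
pose H (p : Cu2 * Cu2) := (f p.1 * g p.2) * ext0 h (Cu2_mul p.1 p.2).
transitivity (csum H).
  apply: eq_csum => p; rewrite /H /G /conv_term /=.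
  case: (Cu2_mul p.1 p.2) => [w|] /=; last first.
    by rewrite (@csum_point _ _ Cu2_e) ?mul0r ?mulr0// => u _; rewrite mul0r.
  rewrite (@csum_point _ _ w) ?eqxx// => u /negPf uw.
  by rewrite (inj_eq Some_inj) eq_sym uw mul0r.
have sH : csummable H.
  apply: (@csummable_bounded _ _ _ _ M) => [|p].
    by apply: csummable_le (psum_prod sf sg).1 => p; rewrite normc_mul.
  exact: translate_bounded.
rewrite csum_fubini//; apply: eq_csum => s; rewrite -csumZ.
  by apply: eq_csum => t; rewrite mulrA.
move/inAP: sg => sg.
by apply: csummable_bounded sg _; exact: translate_bounded.
Qed.

Lemma mulAE f g u : inA f -> inA g -> mulA f g u =
  pairing f (fun s => pairing g (fun t => ext0 (delta R u) (Cu2_mul s t))).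
Proof.
move=> sf sg; rewrite -(pairing_mulA sf sg (normc_delta_le u)).
by rewrite pairing_deltar.
Qed.

Lemma mulA_assoc f g h : inA f -> inA g -> inA h ->
  mulA (mulA f g) h = mulA f (mulA g h).
Proof.
move=> sf sg sh; apply: funext => u.
have dM := normc_delta_le u.
rewrite !mulAE//; try exact: inA_mul.
rewrite (pairing_mulA sf sg (pairing_translate_bounded sh dM)).
apply: eq_pairing => s.
rewrite (pairing_mulA sg sh (translate_bounded dM _)); apply: eq_pairing => t.
have E r : ext0 (fun t => ext0 (delta R u) (Cu2_mul s t)) (Cu2_mul t r) =
    ext0 (delta R u) (obind (fun x => Cu2_mul x r) (Cu2_mul s t)).
  by rewrite Cu2_mulA; case: (Cu2_mul t r).
rewrite (eq_pairing h E); case: (Cu2_mul s t) => [w|] //=.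
by rewrite pairing0r.
Qed.

Lemma mulADl f g h : inA f -> inA g -> inA h ->
  mulA (addA f g) h = addA (mulA f h) (mulA g h).
Proof.
move=> sf sg sh; apply: funext => u; rewrite /addA !mulAE//; last exact: inA_add.
exact: pairingDl (pairing_translate_bounded sh (normc_delta_le u)).
Qed.

Lemma mulABl f g h : inA f -> inA g -> inA h ->
  mulA (subA f g) h = subA (mulA f h) (mulA g h).
Proof.
move=> sf sg sh; apply: funext => u; rewrite /subA !mulAE//; last exact: inA_sub.
exact: pairingBl (pairing_translate_bounded sh (normc_delta_le u)).
Qed.

Lemma mulADr f g h : inA f -> inA g -> inA h ->
  mulA f (addA g h) = addA (mulA f g) (mulA f h).
Proof.
move=> sf sg sh; apply: funext => u; rewrite /addA !mulAE//; last exact: inA_add.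
have dM := normc_delta_le u.
rewrite -(pairingDr sf (pairing_translate_bounded sg dM)
  (pairing_translate_bounded sh dM)).
by apply: eq_pairing => s; rewrite (pairingDl sg sh (translate_bounded dM _)).
Qed.

Lemma mulANr f g : inA f -> inA g -> mulA f (oppA g) = oppA (mulA f g).
Proof.
move=> sf sg; apply: funext => u; rewrite /oppA !mulAE//; last exact: inA_opp.
have dM := normc_delta_le u.
rewrite -(pairingNl sf (pairing_translate_bounded sg dM)).
rewrite /pairing; apply: eq_csum => s.
rewrite -/(pairing _ _) (pairingNl sg (translate_bounded dM _)).
by rewrite /oppA mulrN mulNr.
Qed.

Lemma mulABr f g h : inA f -> inA g -> inA h ->
  mulA f (subA g h) = subA (mulA f g) (mulA f h).
Proof.
by move=> sf sg sh; rewrite [LHS](mulADr sf sg (inA_opp sh)) mulANr.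
Qed.

Lemma mulA1 f : inA f -> mulA f (delta R Cu2_e) = f.
Proof.
move=> sf; apply: funext => u; rewrite mulAE//; last exact: inA_delta.
rewrite -[RHS]pairing_deltar; apply: eq_pairing => s.
by rewrite pairing_deltal Cu2_muls1.
Qed.

Lemma pairing_f0 h M : (forall s, normc (h s) <= M) ->
  pairing (f0 R) h =
  h Cu2_e - h ([:: false], [:: false]) - h ([:: true], [:: true]).
Proof.
move=> hM; have d s := inA_delta s.
by rewrite /f0 (pairingBl _ _ hM) ?(pairingBl _ _ hM) ?pairing_deltal//;
  exact: inA_sub.
Qed.

Lemma invariant_pairing g h M : inA g -> (forall s, normc (h s) <= M) ->
  invariant h -> invariant (fun s => pairing g (fun t => ext0 h (Cu2_mul s t))).
Proof.
move=> sg hM hi a b.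
rewrite -(pairingDr sg (translate_bounded hM _) (translate_bounded hM _)).
by apply: eq_pairing => t; exact: (invariant_translater t hi).
Qed.

Lemma pairing_mul_f0 f g h M : inA f -> inA g ->
  (forall s, normc (h s) <= M) -> invariant h ->
  pairing (mulA (mulA f (f0 R)) g) h = 0.
Proof.
move=> sf sg hM hi; have kM := pairing_translate_bounded sg hM.
rewrite (pairing_mulA (inA_mul sf inA_f0) sg hM) (pairing_mulA sf inA_f0 kM).
apply: pairing0r => s; rewrite (pairing_f0 (translate_bounded kM _)).
have := invariant_translatel s (invariant_pairing sg hM hi) [::] [::].
by rewrite /= => ->; rewrite addrAC addrK subrr.
Qed.

Definition ideal_comb (ab : seq ((Cu2 -> C) * (Cu2 -> C))) : Cu2 -> C :=
  foldr (fun p acc => addA (mulA (mulA p.1 (f0 R)) p.2) acc) (@zeroA R) ab.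

Definition all_inA (ab : seq ((Cu2 -> C) * (Cu2 -> C))) : Prop :=
  forall p, p \in ab -> inA p.1 /\ inA p.2.

Lemma all_inA_cons p ab : all_inA (p :: ab) ->
  [/\ inA p.1, inA p.2 & all_inA ab].
Proof.
move=> H; have [? ?] := H p (mem_head _ _); split=> // q qab.
by apply: H; rewrite inE qab orbT.
Qed.

Lemma inA_gen f g : inA f -> inA g -> inA (mulA (mulA f (f0 R)) g).
Proof. by move=> sf sg; apply: inA_mul => //; apply: inA_mul => //; exact: inA_f0. Qed.

Lemma inA_ideal_comb ab : all_inA ab -> inA (ideal_comb ab).
Proof.
elim: ab => [_|p ab IH /all_inA_cons[p1 p2 /IH ?]]; first exact: inA_zero.
by apply: inA_add => //; exact: inA_gen.
Qed.

Lemma pairing_zerol h : pairing (@zeroA R) h = 0.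
Proof. by rewrite /pairing (@csum_point _ _ Cu2_e) => [|x _]; rewrite mul0r. Qed.

Lemma pairing_ideal_comb ab h M : all_inA ab -> (forall s, normc (h s) <= M) ->
  invariant h -> pairing (ideal_comb ab) h = 0.
Proof.
move=> + hM hi; elim: ab => [_|p ab IH /all_inA_cons[p1 p2 abA]].
  exact: pairing_zerol.
rewrite /= (pairingDl (inA_gen p1 p2) (inA_ideal_comb abA) hM) IH// addr0.
exact: pairing_mul_f0 hM hi.
Qed.

Lemma pairing_inJ j h M : inJ j -> (forall s, normc (h s) <= M) ->
  invariant h -> pairing j h = 0.
Proof.
move=> [sj jJ] hM hi; apply: Normc.eq0_normc; apply/eqP.
rewrite eq_le normc_ge0 andbT; apply/ler_addgt0Pr => e e0; rewrite add0r.
have M0 : 0 <= M := le_trans (normc_ge0 _) (hM Cu2_e).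
have M1 : 0 < M + 1 by rewrite ltr_pwDr.
have [ab [abA /ltW le]] := jJ (e / (M + 1)) (divr_gt0 e0 M1).
have sab := inA_ideal_comb abA.
have -> : pairing j h = pairing (subA j (ideal_comb ab)) h.
  by rewrite (pairingBl sj sab hM) (pairing_ideal_comb abA hM hi) subr0.
apply: le_trans (pairing_bound (inA_sub sj sab) hM) _.
apply: le_trans (ler_wpM2l M0 le) _.
by rewrite mulrA ler_pdivrMr// mulrC ler_pM2l// lerDl.
Qed.

Lemma mul_ideal_comb a ab : inA a -> all_inA ab ->
  mulA a (ideal_comb ab) = ideal_comb [seq (mulA a p.1, p.2) | p <- ab].
Proof.
move=> sa; elim: ab => [_|p ab IH /all_inA_cons[p1 p2 abA]] /=.
  apply: funext => u; rewrite mulAE//; last exact: inA_zero.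
  by rewrite pairing0r// => s; rewrite pairing_zerol.
rewrite mulADr//; [|exact: inA_gen|exact: inA_ideal_comb].
rewrite -!mulA_assoc ?IH//; try exact: inA_f0; exact: inA_mul p1 inA_f0.
Qed.

Lemma ideal_comb_mul a ab : inA a -> all_inA ab ->
  mulA (ideal_comb ab) a = ideal_comb [seq (p.1, mulA p.2 a) | p <- ab].
Proof.
move=> sa; elim: ab => [_|p ab IH /all_inA_cons[p1 p2 abA]] /=.
  apply: funext => u; rewrite mulAE//; last exact: inA_zero.
  exact: pairing_zerol.
rewrite mulADl//; [|exact: inA_gen|exact: inA_ideal_comb].
by rewrite (mulA_assoc _ p2 sa) ?IH//; exact: inA_mul p1 inA_f0.
Qed.

Lemma ideal_comb_cat ab cd :
  ideal_comb (ab ++ cd) = addA (ideal_comb ab) (ideal_comb cd).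
Proof.
elim: ab => [|p ab IH] /=; apply: funext => u; first by rewrite /addA add0r.
by rewrite IH /addA addrA.
Qed.

Lemma inJ_zero : inJ (@zeroA R).
Proof.
split=> [|e e0]; first exact: inA_zero.
exists [::]; split=> //=; rewrite /normA (@psum_point _ _ Cu2_e).
- by rewrite /subA /zeroA subrr normc_zero.
- by move=> x; exact: normc_ge0.
- by move=> x _; rewrite /subA /zeroA subrr normc_zero.
Qed.

Lemma inJ_add f g : inJ f -> inJ g -> inJ (addA f g).
Proof.
move=> [sf fJ] [sg gJ]; split=> [|e e0]; first exact: inA_add.
have e2 : 0 < e / 2 by rewrite divr_gt0.
have [ab [abA le1]] := fJ _ e2; have [cd [cdA le2]] := gJ _ e2.
exists (ab ++ cd); split=> [p|].
  by rewrite mem_cat => /orP[/abA|/cdA].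
rewrite -/(ideal_comb _) ideal_comb_cat.
have -> : subA (addA f g) (addA (ideal_comb ab) (ideal_comb cd)) =
    addA (subA f (ideal_comb ab)) (subA g (ideal_comb cd)).
  by apply: funext => u; rewrite /subA /addA; ring.
apply: le_lt_trans (normA_add _ _) _; try by apply: inA_sub => //; exact: inA_ideal_comb.
by rewrite (splitr e); exact: ltrD.
Qed.

Lemma scaled_eps_bound (N e x : R) : 0 <= N -> 0 < e -> x < e / (N + 1) ->
  N * x < e.
Proof.
move=> N0 e0; have N1 : 0 < N + 1 by rewrite ltr_pwDr.
rewrite ltr_pdivlMr// => xe; have [x0|x0] := leP x 0.
  by apply: le_lt_trans e0; rewrite mulr_ge0_le0.
by apply: le_lt_trans xe; rewrite mulrC ler_pM2l// lerDl.
Qed.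

Lemma inJ_mull a f : inA a -> inJ f -> inJ (mulA a f).
Proof.
move=> sa [sf fJ]; split=> [|e e0]; first exact: inA_mul.
have N1 : 0 < normA a + 1 by rewrite ltr_pwDr// normA_ge0.
have [ab [abA le]] := fJ _ (divr_gt0 e0 N1).
exists [seq (mulA a p.1, p.2) | p <- ab]; split.
  by move=> _ /mapP[p /abA[p1 p2] ->]; split=> //; exact: inA_mul.
have sab := inA_ideal_comb abA.
rewrite -/(ideal_comb _) -mul_ideal_comb// -mulABr//.
apply: le_lt_trans (normA_mul sa (inA_sub sf sab)) _.
exact: scaled_eps_bound (normA_ge0 _) e0 le.
Qed.

Lemma inJ_mulr a f : inA a -> inJ f -> inJ (mulA f a).
Proof.
move=> sa [sf fJ]; split=> [|e e0]; first exact: inA_mul.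
have N1 : 0 < normA a + 1 by rewrite ltr_pwDr// normA_ge0.
have [ab [abA le]] := fJ _ (divr_gt0 e0 N1).
exists [seq (p.1, mulA p.2 a) | p <- ab]; split.
  by move=> _ /mapP[p /abA[p1 p2] ->]; split=> //; exact: inA_mul.
have sab := inA_ideal_comb abA.
rewrite -/(ideal_comb _) -ideal_comb_mul// -mulABl//.
apply: le_lt_trans (normA_mul (inA_sub sf sab) sa) _; rewrite mulrC.
exact: scaled_eps_bound (normA_ge0 _) e0 le.
Qed.

Lemma inJ_opp f : inJ f -> inJ (oppA f).
Proof.
move=> fJ; have sf := fJ.1; have s1 := inA_opp (inA_delta Cu2_e).
have := inJ_mulr s1 fJ.
by rewrite mulANr ?mulA1//; exact: inA_delta.
Qed.

End ConvolutionAlgebra.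

Section QuotientNorm.
Variable R : realType.
Local Notation C := R[i].
Local Notation normc := (@Normc.normc R).
Local Arguments Cu2_mul : simpl never.
Local Arguments Normc.normc : simpl never.
Implicit Types (f g h j : Cu2 -> C) (M : R).

Lemma qnorm_lbound f : has_lbound [set normA (subA f j) | j in @inJ R].
Proof. by exists 0 => _ [j _ <-]; exact: normA_ge0. Qed.

Lemma qnorm_le f j : inJ j -> qnorm f <= normA (subA f j).
Proof. by move=> jJ; apply: ge_inf; [exact: qnorm_lbound|exists j]. Qed.

Lemma subA0 f : subA f (@zeroA R) = f.
Proof. by apply: funext => u; rewrite /subA subr0. Qed.

Lemma qnorm_le_normA f : qnorm f <= normA f.
Proof. by have := qnorm_le f (inJ_zero R); rewrite subA0. Qed.

Lemma qnorm_approx f e : 0 < e ->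
  exists2 j, inJ j & normA (subA f j) < qnorm f + e.
Proof.
move=> e0; have [|_ [j jJ <-] lt] := @inf_adherent R
  [set normA (subA f j) | j in @inJ R] e e0; last by exists j.
split; last exact: qnorm_lbound.
by exists (normA (subA f (@zeroA R))), (@zeroA R) => //; exact: inJ_zero.
Qed.

Lemma qnorm_ge0 f : 0 <= qnorm f.
Proof.
apply: lb_le_inf; last by move=> _ [j _ <-]; exact: normA_ge0.
by exists (normA (subA f (@zeroA R))), (@zeroA R) => //; exact: inJ_zero.
Qed.

Lemma qnorm_opp f : inA f -> qnorm (oppA f) <= qnorm f.
Proof.
move=> sf; apply/ler_addgt0Pr => e e0; have [j jJ /ltW le] := qnorm_approx f e0.
apply: le_trans (qnorm_le _ (inJ_opp jJ)) _; apply: le_trans le.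
rewrite le_eqVlt; apply/orP; left; apply/eqP; apply: eq_psum => s.
by rewrite /subA /oppA -normc_opp; congr (Normc.normc _); ring.
Qed.

Lemma qnorm_add f g : inA f -> inA g -> qnorm (addA f g) <= qnorm f + qnorm g.
Proof.
move=> sf sg; apply/ler_addgt0Pr => e e0; have e2 : 0 < e / 2 by rewrite divr_gt0.
have [j jJ /ltW le1] := qnorm_approx f e2.
have [k kJ /ltW le2] := qnorm_approx g e2.
apply: le_trans (qnorm_le _ (inJ_add jJ kJ)) _.
have -> : subA (addA f g) (addA j k) = addA (subA f j) (subA g k).
  by apply: funext => u; rewrite /subA /addA; ring.
apply: le_trans (normA_add (inA_sub sf jJ.1) (inA_sub sg kJ.1)) _.
by apply: le_trans (lerD le1 le2) _; rewrite addrACA -splitr.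
Qed.

(* The slack [+ 1] is harmless: only boundedness of products is needed. *)
Lemma qnorm_mul_le f g : inA f -> inA g ->
  qnorm (mulA f g) <= (qnorm f + 1) * (qnorm g + 1).
Proof.
move=> sf sg; have [j jJ /ltW le1] := qnorm_approx f ltr01.
have [k kJ /ltW le2] := qnorm_approx g ltr01.
have sj := jJ.1; have sk := kJ.1; have sfj := inA_sub sf sj.
have KJ : inJ (addA (mulA j g) (mulA (subA f j) k)).
  by apply: inJ_add; [exact: inJ_mulr|exact: inJ_mull].
apply: le_trans (qnorm_le _ KJ) _.
have -> : subA (mulA f g) (addA (mulA j g) (mulA (subA f j) k)) =
    mulA (subA f j) (subA g k).
  rewrite (mulABr sfj sg sk) (mulABl sf sj sg).
  by apply: funext => u; rewrite /subA /addA opprD addrA.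
apply: le_trans (normA_mul sfj (inA_sub sg sk)) _.
by apply: ler_pM => //; exact: normA_ge0.
Qed.

Lemma pairing_qnorm f h M : inA f -> (forall s, normc (h s) <= M) ->
  invariant h -> normc (pairing f h) <= M * qnorm f.
Proof.
move=> sf hM hi; have M0 : 0 <= M := le_trans (normc_ge0 _) (hM Cu2_e).
have le j : inJ j -> normc (pairing f h) <= M * normA (subA f j).
  move=> jJ; have -> : pairing f h = pairing (subA f j) h.
    by rewrite (pairingBl sf jJ.1 hM) (pairing_inJ jJ hM hi) subr0.
  exact: pairing_bound (inA_sub sf jJ.1) hM.
apply/ler_addgt0Pr => e e0; have M1 : 0 < M + 1 by rewrite ltr_pwDr.
have [j jJ lt] := qnorm_approx f (divr_gt0 e0 M1).
apply: le_trans (le j jJ) _; apply: le_trans (ler_wpM2l M0 (ltW lt)) _.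
rewrite mulrDr lerD2l mulrA ler_pdivrMr// mulrC ler_pM2l// lerDl.
exact: ler01.
Qed.

End QuotientNorm.

Section AveragedWords.
Variable R : realType.
Local Notation C := R[i].
Local Notation normc := (@Normc.normc R).
Local Arguments Cu2_mul : simpl never.
Local Arguments Normc.normc : simpl never.

Lemma csum_sum (T : choiceType) (I : Type) (r : seq I) (F : I -> T -> C) :
  (forall i, csummable (F i)) ->
  csummable (fun x => \sum_(i <- r) F i x) /\
  csum (fun x => \sum_(i <- r) F i x) = \sum_(i <- r) csum (F i).
Proof.
move=> sF; elim: r => [|i r [IH1 IH2]].
  have E : (fun x => \sum_(i <- [::]) F i x) = (fun=> 0).
    by apply: funext => x; rewrite big_nil.
  rewrite E big_nil; split.
    split=> [x|]; first exact: normc_ge0.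
    by rewrite esum1 ?ltry// => x _; rewrite normc_zero.
  apply: complex_eq => /=; rewrite /rsum /psum !esum1 ?subrr// => x _;
    by rewrite ?oppr0 maxxx.
have E : (fun x => \sum_(k <- i :: r) F k x) =
    (fun x => F i x + \sum_(k <- r) F k x).
  by apply: funext => x; rewrite big_cons.
rewrite E big_cons; split; first exact: csummableD.
by rewrite csumD// IH2.
Qed.

Lemma normc_real (r : R) : 0 <= r -> normc (Complex r 0) = r.
Proof. by move=> r0; rewrite /Normc.normc expr0n addr0 sqrtr_sqr ger0_norm. Qed.

Definition word_average (n : nat) : Cu2 -> C := fun s =>
  if (size s.1 == n) && (s.2 == [::]) then Complex (2 ^- n) 0 else 0.

Lemma word_averageE n h s : word_average n s * h s =
  \sum_(w : n.-tuple bool)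
    (if s == (val w, [::]) then Complex (2 ^- n) 0 * h s else 0).
Proof.
rewrite /word_average; case: s => a b /=; have [sa|sa] /= := boolP (size a == n).
  have [->|b0] := eqVneq b [::].
    rewrite (bigD1 (Tuple sa))//= eqxx big1 ?addr0//.
    by move=> w /eqP wa; case: eqP => // -[e]; case: wa; apply: val_inj.
  rewrite big1 ?mul0r// => w _; case: eqP => // -[_ e].
  by rewrite e eqxx in b0.
rewrite big1 ?mul0r// => w _; case: eqP => // -[e _].
by rewrite e size_tuple eqxx in sa.
Qed.

Lemma pairing_word_average n h : csummable (fun s => word_average n s * h s) /\
  pairing (word_average n) h =
  Complex (2 ^- n) 0 * \sum_(w : n.-tuple bool) h (val w, [::]).
Proof.
pose F (w : n.-tuple bool) (s : Cu2) : C :=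
  if s == (val w, [::]) then Complex (2 ^- n) 0 * h s else 0.
have F0 w s : s != (val w, [::]) -> F w s = 0 by rewrite /F => /negPf ->.
have [|s e] := @csum_sum _ _ (index_enum _) F.
  by move=> w; apply: csummable_point; exact: F0.
have E : (fun s => word_average n s * h s) = (fun s => \sum_w F w s).
  by apply: funext => s'; rewrite word_averageE.
rewrite /pairing E; split=> //; rewrite e mulr_sumr; apply: eq_bigr => w _.
by rewrite (csum_point (F0 w)) /F eqxx.
Qed.

Lemma pairing_word_average_const n h :
  (forall w : n.-tuple bool, h (val w, [::]) = 1) ->
  pairing (word_average n) h = 1.
Proof.
move=> h1; rewrite (pairing_word_average n h).2.
rewrite (eq_bigr (fun=> 1)) => [|w _]; last exact: h1.
rewrite sumr_const card_tuple card_bool.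
have -> : (1 *+ 2 ^ n : C) = Complex (2 ^+ n) 0.
  by rewrite natrX -(rmorph_nat (real_complex R) 2) -rmorphXn.
apply: complex_eq; rewrite ?(ReM, ImM) /=; last by rewrite mulr0 mul0r addr0.
by rewrite mulr0 subr0 mulVf// expf_neq0.
Qed.

Lemma inA_word_average n : inA (word_average n).
Proof.
apply/inAP; have := (pairing_word_average n (fun=> 1)).1.
by congr csummable; apply: funext => s; rewrite mulr1.
Qed.

Lemma normA_word_average n : normA (word_average n) = 1.
Proof.
have s := (inAP _).1 (inA_word_average n).
have := @pairing_word_average_const n (fun=> 1) (fun=> erefl).
move=> /(congr1 (@complex.Re R)) /= => <-.
have z0 : psummable (fun _ : Cu2 => 0 : R).
  by apply: (@psummable_point _ _ Cu2_e).
rewrite (rsum_diff s z0); last first.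
  move=> x; rewrite mulr1 subr0 /word_average; case: ifP => _.
    by rewrite normc_real// invr_ge0 exprn_ge0.
  by rewrite normc_zero.
by rewrite [X in _ - X](@psum_point _ _ Cu2_e)// subr0.
Qed.

Lemma comparable_words_eq a b :
  size a = size b -> comparable_words a b -> a = b.
Proof.
move=> sab /orP[]; rewrite prefixE ?sab; last rewrite -sab.
  by rewrite take_size => /eqP.
by rewrite take_size => /eqP.
Qed.

Lemma pairing_word_average_chain n h M : (forall s, normc (h s) <= M) ->
  chain_supported h -> normc (pairing (word_average n) h) <= 2 ^- n * M.
Proof.
move=> hM hc; have p2 : (0 : R) <= 2 ^- n by rewrite invr_ge0 exprn_ge0.
rewrite (pairing_word_average n h).2 normc_mul normc_real// ler_wpM2l//.
have M0 : 0 <= M := le_trans (normc_ge0 _) (hM Cu2_e).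
have [/existsP[w hw]|/existsPn h0] :=
    boolP [exists w : n.-tuple bool, h (val w, [::]) != 0]; last first.
  by rewrite big1 ?normc_zero// => w _; apply/eqP; have := h0 w; rewrite negbK.
rewrite (bigD1 w)//= big1 ?addr0// => v vw; apply/eqP; apply: contraNT vw => hv.
apply/eqP/val_inj/comparable_words_eq; first by rewrite !size_tuple.
exact: (hc _ _ hv hw).
Qed.

(* The letter 1 is encoded by [false], so [weight_right] is phi. *)
Definition weight_left : Cu2 -> C := fun s => (all negb s.1)%:R.
Definition weight_right : Cu2 -> C := fun s => (all negb s.2)%:R.

Lemma invariant_weight_left : invariant weight_left.
Proof. by move=> a b; rewrite /weight_left /= !all_cat /= andbT andbF addr0. Qed.

Lemma invariant_weight_right : invariant weight_right.
Proof. by move=> a b; rewrite /weight_right /= !all_cat /= andbT andbF addr0. Qed.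

Lemma normc_bool_le (b : bool) : normc b%:R <= 1.
Proof. by case: b; rewrite ?normc_zero// (Normc.normc1 R). Qed.

Lemma chain_supported_weight_left : chain_supported weight_left.
Proof.
move=> [a b] [c d]; rewrite /weight_left /= !pnatr_eq0 !eqb0 !negbK.
elim: a c => [|x a IH] [|y c] //= /andP[/negPf -> aa] /andP[/negPf -> cc].
exact: IH.
Qed.

End AveragedWords.

Section UltrapowerIdeal.
Variable R : realType.
Variable U : set_system nat.
Local Notation C := R[i].
Local Notation normc := (@Normc.normc R).
Local Arguments Cu2_mul : simpl never.
Local Arguments Normc.normc : simpl never.
Implicit Types (f g h : Cu2 -> C) (M e : R) (x y r : nat -> Cu2 -> C).

Lemma UP_car_add x y : UP_car x -> UP_car y -> UP_car (fun n => addA (x n) (y n)).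
Proof.
move=> [sx [M xM]] [sy [N yN]]; split=> [n|]; first exact: inA_add.
exists (M + N) => n; apply: le_trans (qnorm_add (sx n) (sy n)) _.
exact: lerD.
Qed.

Lemma UP_car_opp x : UP_car x -> UP_car (fun n => oppA (x n)).
Proof.
move=> [sx [M xM]]; split=> [n|]; first exact: inA_opp.
by exists M => n; apply: le_trans (qnorm_opp (sx n)) _.
Qed.

Lemma UP_car_mul x y : UP_car x -> UP_car y -> UP_car (fun n => mulA (x n) (y n)).
Proof.
move=> [sx [M xM]] [sy [N yN]]; split=> [n|]; first exact: inA_mul.
exists ((M + 1) * (N + 1)) => n; apply: le_trans (qnorm_mul_le (sx n) (sy n)) _.
by apply: ler_pM; rewrite ?lerD2r// addr_ge0 ?qnorm_ge0.
Qed.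

Lemma UP_car_one : UP_car (fun _ => delta R Cu2_e).
Proof.
split=> [n|]; first exact: inA_delta.
by exists (normA (delta R Cu2_e)) => n; exact: qnorm_le_normA.
Qed.

Lemma UP_car_word_average : UP_car (@word_average R).
Proof.
split=> [n|]; first exact: inA_word_average.
by exists 1 => n; rewrite -(normA_word_average R n); exact: qnorm_le_normA.
Qed.

(* A weight supported on pairs [(a, b)] with [a] in a chain is a matrix
   coefficient of the representation of A/J on bounded functions on the
   boundary, so [chain_norm_le f e] says that [f] has norm at most [e] there. *)
Definition chain_norm_le f e : Prop := forall h M,
  (forall s, normc (h s) <= M) -> invariant h -> chain_supported h ->
  normc (pairing f h) <= e * M.

Lemma chain_norm_le_trans f e e' : e <= e' ->
  chain_norm_le f e -> chain_norm_le f e'.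
Proof.
move=> ee fe h M hM hi hc; apply: le_trans (fe h M hM hi hc) _.
rewrite ler_wpM2r//; exact: le_trans (normc_ge0 _) (hM Cu2_e).
Qed.

Lemma chain_norm_le_qnorm f : inA f -> chain_norm_le f (qnorm f).
Proof. by move=> sf h M hM hi _; rewrite mulrC; exact: pairing_qnorm. Qed.

Lemma chain_norm_le_add f g e e' : inA f -> inA g ->
  chain_norm_le f e -> chain_norm_le g e' -> chain_norm_le (addA f g) (e + e').
Proof.
move=> sf sg fe ge h M hM hi hc; rewrite (pairingDl sf sg hM) mulrDl.
by apply: le_trans (normc_add _ _) _; apply: lerD; [exact: fe|exact: ge].
Qed.

Lemma chain_norm_le_opp f e : inA f ->
  chain_norm_le f e -> chain_norm_le (oppA f) e.
Proof.
by move=> sf fe h M hM hi hc; rewrite (pairingNl sf hM) normc_opp; exact: fe.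
Qed.

Lemma chain_supported_pairing g h : chain_supported h ->
  chain_supported (fun s => pairing g (fun t => ext0 h (Cu2_mul s t))).
Proof.
move=> hc s s'; have aux s1 :
    pairing g (fun t => ext0 h (Cu2_mul s1 t)) != 0 ->
    exists2 u, h u != 0 & exists m, u.1 = s1.1 ++ m.
  move=> nz; have [//|nt] :=
    pselect (exists2 u, h u != 0 & exists m, u.1 = s1.1 ++ m).
  move: nz; rewrite pairing0r ?eqxx// => t.
  case E : (Cu2_mul s1 t) => [u|] //=; apply/eqP/negPn/negP => hu.
  by apply: nt; exists u => //; exact: Cu2_mul_fst E.
move=> /aux[u hu [m um]] /aux[v hv [m' vm]].
have := hc _ _ hu hv; rewrite um vm.
by move=> /comparable_words_catr /comparable_words_catl.
Qed.

Lemma chain_norm_le_mul f g e e' : inA f -> inA g ->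
  chain_norm_le f e -> chain_norm_le g e' -> chain_norm_le (mulA f g) (e * e').
Proof.
move=> sf sg fe ge h M hM hi hc; rewrite (pairing_mulA sf sg hM) -mulrA.
apply: fe => [s||].
- apply: ge => [t||]; first exact: translate_bounded.
    exact: invariant_translatel.
  exact: chain_supported_translatel.
- exact: invariant_pairing hM hi.
- exact: chain_supported_pairing.
Qed.

Definition chain_null x : Prop :=
  UP_car x /\ forall e, 0 < e -> U [set n | chain_norm_le (x n) e].

Lemma chain_null_ideal : Filter U -> @sr_ideal (UP_ring R U) chain_null.
Proof.
move=> FU; have mulE e N : 0 < e -> 0 <= N -> e / (N + 1) * N <= e.
  move=> e0 N0; rewrite mulrAC ler_pdivrMr ?ltr_pwDr//.
  by rewrite ler_pM2l// lerDl.
split; first by move=> x [].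
split.
  split=> [|e e0 /=].
    split=> [n|]; first exact: inA_zero.
    by exists (normA (@zeroA R)) => n; exact: qnorm_le_normA.
  apply: filterS filterT => n _ h M hM _ _; rewrite pairing_zerol normc_zero.
  by rewrite mulr_ge0 ?(ltW e0)//; exact: le_trans (normc_ge0 _) (hM Cu2_e).
split.
  move=> x y [cx nx] [cy ny]; split=> [|e e0]; first exact: UP_car_add.
  have e2 : 0 < e / 2 by rewrite divr_gt0.
  apply: filterS2 (nx _ e2) (ny _ e2) => n /= xn yn.
  by rewrite (splitr e); exact: chain_norm_le_add (cx.1 n) (cy.1 n) xn yn.
split.
  move=> x [cx nx]; split=> [|e e0]; first exact: UP_car_opp.
  by apply: filterS (nx _ e0) => n /=; exact: chain_norm_le_opp (cx.1 n).
split.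
  move=> x r [cx nx] cr; have [sr [N rN]] := cr.
  have N0 : 0 <= N := le_trans (qnorm_ge0 _) (rN 0%N).
  have rc n : chain_norm_le (r n) N.
    exact: chain_norm_le_trans (rN n) (chain_norm_le_qnorm (sr n)).
  split; (split=> [|e e0]; first exact: UP_car_mul);
    have N1 : 0 < N + 1 by rewrite ltr_pwDr.
    apply: filterS (nx _ (divr_gt0 e0 N1)) => n /= xn.
    apply: chain_norm_le_trans (mulE e N e0 N0) _; rewrite mulrC.
    exact: chain_norm_le_mul (sr n) (cx.1 n) (rc n) xn.
  apply: filterS (nx _ (divr_gt0 e0 N1)) => n /= xn.
  apply: chain_norm_le_trans (mulE e N e0 N0) _.
  exact: chain_norm_le_mul (cx.1 n) (sr n) xn (rc n).
move=> x y [cx nx] cy xy; split=> // e e0.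
have e2 : 0 < e / 2 by rewrite divr_gt0.
apply: filterS2 (nx _ e2) (xy _ e2) => n /= xn /ltW xyn.
have sxy := inA_sub (cx.1 n) (cy.1 n).
have -> : y n = addA (x n) (oppA (subA (x n) (y n))).
  by apply: funext => u; rewrite /addA /oppA /subA opprB addrC subrK.
rewrite (splitr e); apply: chain_norm_le_add => //; [exact: cx.1|exact: inA_opp|].
apply: chain_norm_le_opp => //.
exact: chain_norm_le_trans xyn (chain_norm_le_qnorm sxy).
Qed.

Lemma one_not_chain_null : ProperFilter U -> ~ chain_null (fun _ => delta R Cu2_e).
Proof.
move=> PU [_ /(_ 2^-1)]; rewrite invr_gt0 => /(_ (ltr0n _ 2)) /filter_ex[_ /=].
move=> /(_ (@weight_left R) 1 (fun s => normc_bool_le R _)).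
move=> /(_ (@invariant_weight_left R) (@chain_supported_weight_left R)).
rewrite pairing_deltal /weight_left /= (Normc.normc1 R) mulr1; lra.
Qed.

Lemma word_average_neq0 : ProperFilter U ->
  ~ UP_eq U (@word_average R) (fun _ => @zeroA R).
Proof.
move=> PU /(_ 1 ltr01) /filter_ex[n /=]; rewrite subA0 ltNge => /negP; apply.
have := @pairing_qnorm R _ _ 1 (inA_word_average R n)
  (fun s => normc_bool_le R _) (@invariant_weight_right R).
by rewrite pairing_word_average_const// (Normc.normc1 R) mul1r.
Qed.

Lemma nonprincipal_cofinal : nonprincipal_ultrafilter U ->
  forall N, U [set n | (N <= n)%N].
Proof.
move=> [UU np]; elim=> [|N IH]; first by apply: filterS filterT.
have [/np//|UN] := in_ultra_setVsetC [set N] UU.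
apply: filterS2 IH UN => n /= Nn nN.
by rewrite ltn_neqAle Nn andbT eq_sym; apply/eqP.
Qed.

Lemma word_average_chain_null :
  nonprincipal_ultrafilter U -> chain_null (@word_average R).
Proof.
move=> nU; have [UU _] := nU; split=> [|e e0]; first exact: UP_car_word_average.
apply: filterS (nonprincipal_cofinal nU (Num.Def.archi_bound e^-1)) => n /= Nn.
have le : 2 ^- n <= e.
  rewrite -[leRHS]invrK lef_pV2 ?posrE ?invr_gt0// ?exprn_gt0//.
  have ei : 0 <= e^-1 by rewrite invr_ge0 ltW.
  apply: le_trans (ltW (archi_boundP ei)) _.
  rewrite -natrX ler_nat; apply: leq_trans Nn (ltnW _); exact: ltn_expl.
apply: chain_norm_le_trans le _ => h M hM _ hc.
exact: pairing_word_average_chain.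
Qed.

End UltrapowerIdeal.

Theorem theorem3p22 (R : realType) (U : set_system nat) :
  nonprincipal_ultrafilter U ->
  ~ sr_simple (UP_ring R U) /\ ~ sr_purely_infinite (UP_ring R U).
Proof.
move=> nU; have [UU _] := nU.
have PU : ProperFilter U by exact: ultra_proper.
have ideal : @sr_ideal (UP_ring R U) (@chain_null R U).
  exact: chain_null_ideal.
have one := @one_not_chain_null R U PU.
have avg := word_average_chain_null R nU.
have avg0 := @word_average_neq0 R U PU.
split=> [[_ simple]|[_ pinf]].
  by have [/(_ _ avg)|] := simple _ ideal.
have [b [c [cb [cc bac]]]] := pinf _ avg.1 avg0.
have [_ [_ [_ [_ [absorb sat]]]]] := ideal.
apply: one; apply: sat bac; last exact: UP_car_one.
by apply: (absorb _ c _ cc).2; exact: (absorb _ b avg cb).1.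
Qed.
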